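(* Let $A=H+Si\in M_n(\mathbb{C})$, where $H\in M_n(\mathbb{C})$ is Hermitian and $S\in M_n(\mathbb{R})$ is diagonal. Let $$\mathcal{D}_0=\{(\boldsymbol{x},\boldsymbol{y})\in\mathbb{S}_{\mathbb{C}^{2n}}:\ \boldsymbol{q}^*A\boldsymbol{q}\in B(A),\text{ where }\boldsymbol{q}=\boldsymbol{x}+\boldsymbol{y}j\in\mathbb{S}_{\mathbb{H}^n}\}.$$ Then $$\mathcal{D}_0=\{(\boldsymbol{x},\boldsymbol{y})\in\mathbb{S}_{\mathbb{C}^{2n}}:\ \boldsymbol{x}^*S\boldsymbol{y}=0\}$$ and $$B(A)=\{\boldsymbol{x}^*A\boldsymbol{x}+\boldsymbol{y}^*A^*\boldsymbol{y}:\ (\boldsymbol{x},\boldsymbol{y})\in\mathcal{D}_0\}.$$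
   Context: $\mathbb{H}$ denotes the Hamilton quaternions with real basis $1,i,j,k$, and $\mathbb{C}=\mathrm{span}_{\mathbb{R}}\{1,i\}\subset\mathbb{H}$. Vectors are columns, and $^*$ denotes conjugate transpose. $\mathbb{S}_{\mathbb{F}^m}$ is the unit sphere $\{\boldsymbol{x}\in\mathbb{F}^m:\boldsymbol{x}^*\boldsymbol{x}=1\}$ for $\mathbb{F}=\mathbb{C},\mathbb{H}$; every $\boldsymbol{q}\in\mathbb{H}^n$ is uniquely $\boldsymbol{x}+\boldsymbol{y}j$ with $\boldsymbol{x},\boldsymbol{y}\in\mathbb{C}^n$, and pairs $(\boldsymbol{x},\boldsymbol{y})$ are regarded as elements of $\mathbb{C}^{2n}$. The quaternionic numerical range is $W_{\mathbb{H}}(A)=\{\boldsymbol{q}^*A\boldsymbol{q}:\boldsymbol{q}\in\mathbb{S}_{\mathbb{H}^n}\}$ and the bild of $A$ is $B(A)=W_{\mathbb{H}}(A)\cap\mathbb{C}$. *)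

(* Defs.v *)
From HB Require Import structures.
From mathcomp Require Import all_boot all_order all_algebra.
From mathcomp Require Import sesquilinear spectral complex.
From mathcomp Require Import classical_sets reals.
From mathcomp Require Import ring.

Set Implicit Arguments.
Unset Strict Implicit.
Unset Printing Implicit Defensive.

Import Order.TTheory GRing.Theory Num.Theory.

Local Open Scope ring_scope.
Local Open Scope sesquilinear_scope.
Local Open Scope classical_set_scope.

(* Quat a b c d stands for a + b i + c j + d k. *)
Record quat (R : Type) := Quat { qre : R; qi : R; qj : R; qk : R }.

Section QuatChoice.
Variable R : choiceType.

Definition quat_to_tuple (q : quat R) : R * R * R * R :=
  (qre q, qi q, qj q, qk q).
Definition tuple_to_quat (t : R * R * R * R) : quat R :=
  let: (a, b, c, d) := t in Quat a b c d.

Lemma quat_to_tupleK : cancel quat_to_tuple tuple_to_quat.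
Proof. by case. Qed.

HB.instance Definition _ := Choice.copy (quat R) (can_type quat_to_tupleK).

End QuatChoice.

Section QuatRing.
Variable R : realType.

Implicit Types p q r : quat R.

Definition addq p q : quat R :=
  let: Quat a b c d := p in let: Quat a' b' c' d' := q in
  Quat (a + a') (b + b') (c + c') (d + d').

Definition oppq p : quat R :=
  let: Quat a b c d := p in Quat (- a) (- b) (- c) (- d).

Definition mulq p q : quat R :=
  let: Quat a b c d := p in let: Quat a' b' c' d' := q in
  Quat (a * a' - b * b' - c * c' - d * d')
       (a * b' + b * a' + c * d' - d * c')
       (a * c' - b * d' + c * a' + d * b')
       (a * d' + b * c' - c * b' + d * a').

Let zeroq : quat R := Quat 0 0 0 0.
Let oneq : quat R := Quat 1 0 0 0.

Fact addqA : associative addq.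
Proof. by move=> [????] [????] [????] /=; rewrite !addrA. Qed.

Fact addqC : commutative addq.
Proof. by move=> [a b c d] [????] /=; congr Quat; apply: addrC. Qed.

Fact add0q : left_id zeroq addq.
Proof. by move=> [????] /=; rewrite !add0r. Qed.

Fact addNq : left_inverse zeroq oppq addq.
Proof. by move=> [????] /=; rewrite !addNr. Qed.

HB.instance Definition _ :=
  GRing.isZmodule.Build (quat R) addqA addqC add0q addNq.

Fact mulqA : associative mulq.
Proof. by move=> [????] [????] [????] /=; congr Quat; ring. Qed.

Fact mul1q : left_id oneq mulq.
Proof. by move=> [????] /=; congr Quat; ring. Qed.

Fact mulq1 : right_id oneq mulq.
Proof. by move=> [????] /=; congr Quat; ring. Qed.

Fact mulqDl : left_distributive mulq addq.
Proof. by move=> [????] [????] [????] /=; congr Quat; ring. Qed.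

Fact mulqDr : right_distributive mulq addq.
Proof. by move=> [????] [????] [????] /=; congr Quat; ring. Qed.

Fact oneq_neq0 : oneq != zeroq.
Proof. by apply/eqP => -[] /eqP; rewrite oner_eq0. Qed.

HB.instance Definition _ := GRing.Zmodule_isNzRing.Build (quat R)
  mulqA mul1q mulq1 mulqDl mulqDr oneq_neq0.

Definition conjq q : quat R :=
  let: Quat a b c d := q in Quat a (- b) (- c) (- d).

Definition unit_i : quat R := Quat 0 1 0 0.
Definition unit_j : quat R := Quat 0 0 1 0.
Definition unit_k : quat R := Quat 0 0 0 1.

Lemma hamilton_relations :
  [/\ unit_i * unit_i = -1, unit_j * unit_j = -1, unit_k * unit_k = -1
    & unit_i * unit_j * unit_k = -1].
Proof. by split; congr Quat => /=; ring. Qed.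

Definition CtoH (z : R[i]) : quat R :=
  Quat (complex.Re z) (complex.Im z) 0 0.

Fact CtoH_is_zmod_morphism : zmod_morphism CtoH.
Proof. by move=> [a b] [c d]; congr Quat => /=; rewrite ?subrr. Qed.

Fact CtoH_is_monoid_morphism : monoid_morphism CtoH.
Proof. by split=> // -[a b] [c d]; congr Quat => /=; ring. Qed.

HB.instance Definition _ :=
  GRing.isZmodMorphism.Build R[i] (quat R) CtoH CtoH_is_zmod_morphism.
HB.instance Definition _ :=
  GRing.isMonoidMorphism.Build R[i] (quat R) CtoH CtoH_is_monoid_morphism.

End QuatRing.

Arguments unit_i {R}.
Arguments unit_j {R}.
Arguments unit_k {R}.

Notation "M ^H*" := (map_mx (@conjq _) (M ^T)) (at level 30) : ring_scope.

Section Bild.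
Variable R : realType.

Definition sphereC m : set 'cV[R[i]]_m := [set v | v ^t* *m v = 1%:M].

Definition sphereH m : set 'cV[quat R]_m := [set q | q ^H* *m q = 1%:M].

(* The set S_{C^{2n}}, whose elements are viewed as pairs (x, y). *)
Definition sphereC2 n : set ('cV[R[i]]_n * 'cV[R[i]]_n) :=
  [set xy | sphereC (col_mx xy.1 xy.2)].

Variable n : nat.

(* The vector x + y j; the unit j multiplies each entry of y on the right. *)
Definition joinH (x y : 'cV[R[i]]_n) : 'cV[quat R]_n :=
  map_mx (@CtoH R) x + map_mx (fun z => CtoH z * unit_j) y.

Lemma joinH_unique (q : 'cV[quat R]_n) : exists! xy, q = joinH xy.1 xy.2.
Proof.
have joinE x y a : joinH x y a 0 =
    Quat (complex.Re (x a 0)) (complex.Im (x a 0))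
         (complex.Re (y a 0)) (complex.Im (y a 0)).
  rewrite !mxE; case: (x a 0) (y a 0) => [b c] [d e].
  rewrite -[LHS]/(addq (CtoH (Complex b c)) (mulq (CtoH (Complex d e)) unit_j)).
  by rewrite /=; congr Quat; ring.
exists (\col_a Complex (qre (q a 0)) (qi (q a 0)),
        \col_a Complex (qj (q a 0)) (qk (q a 0))); split=> [|[x y] /= ->].
  by apply/colP => a; rewrite [RHS]joinE !mxE /=; case: (q a 0).
by congr pair; apply/colP => a; rewrite mxE joinE /=;
  [case: (x a 0) | case: (y a 0)].
Qed.

Definition qformH (A : 'M[quat R]_n) (q : 'cV[quat R]_n) : quat R :=
  (q ^H* *m A *m q) 0 0.

Definition qnumrange (A : 'M[quat R]_n) : set (quat R) :=
  [set qformH A q | q in @sphereH n].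

Definition bild (A : 'M[quat R]_n) : set (quat R) :=
  qnumrange A `&` range (@CtoH R).

Definition D0 (A : 'M[R[i]]_n) : set ('cV[R[i]]_n * 'cV[R[i]]_n) :=
  [set xy | sphereC2 xy /\
    let q := joinH xy.1 xy.2 in
    sphereH q /\
    bild (map_mx (@CtoH R) A) (qformH (map_mx (@CtoH R) A) q)].

End Bild.

(* Main.v *)
(** Moving [j] to the right through complex matrices gives, for q = x + y j,
    q^* A q = (x^* A x + y^* A^* y) + (x^* (A - A^* ) y) j.
    For A = I this identifies the two unit spheres; for A = H + S i, where
    A - A^* = 2 i S, it shows that q^* A q is complex exactly when
    x^* S y = 0. *)
Require Import Defs.
From mathcomp Require Import all_boot all_order all_algebra.
From mathcomp Require Import sesquilinear spectral complex.
From mathcomp Require Import classical_sets reals.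
From mathcomp Require Import ring.

Import Order.TTheory GRing.Theory Num.Theory.

Local Open Scope ring_scope.
Local Open Scope complex_scope.
Local Open Scope sesquilinear_scope.
Local Open Scope classical_set_scope.

(** Stated over any nonzero ring, with the factors in order, so that it serves both over [R[i]] and
    over the noncommutative quaternions. *)
Lemma mx_formE (K : nzRingType) (m p : nat)
    (u : 'rV[K]_m) (M : 'M[K]_(m, p)) (v : 'cV[K]_p) :
  (u *m M *m v) 0 0 = \sum_a \sum_b u 0 a * M a b * v b 0.
Proof.
rewrite mxE exchange_big /=; apply: eq_bigr => b _.
by rewrite mxE big_distrl.
Qed.

Lemma CtoH_joinE (R : realType) (u v : R[i]) :
  CtoH u + CtoH v * unit_j =
  Quat (complex.Re u) (complex.Im u) (complex.Re v) (complex.Im v).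
Proof.
case: u v => [a b] [c d].
rewrite -[LHS]/(Defs.addq (Quat a b 0 0) (Defs.mulq (Quat c d 0 0) unit_j)) /=.
by congr Quat; ring.
Qed.

(** The j and k components of u + v j are the real and imaginary parts of v. *)
Lemma CtoH_join_range (R : realType) (u v : R[i]) :
  range (@CtoH R) (CtoH u + CtoH v * unit_j) <-> v = 0.
Proof.
split=> [[w _]|->]; last by exists u; rewrite // rmorph0 mul0r addr0.
by rewrite CtoH_joinE => -[_ _]; case: v => c d /= <- <-.
Qed.

Lemma CtoH_inj (R : realType) : injective (@CtoH R).
Proof. by move=> [a b] [c d] [-> ->]. Qed.

(** The rule j z = z^* j turns the conjugate of xa + ya j into xa^* - ya j, and j^2 = -1 gives the
    plus sign in the complex part. *)
Lemma joinH_form_entry (R : realType) (xa ya c xb yb : R[i]) :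
  conjq (CtoH xa + CtoH ya * unit_j) * CtoH c * (CtoH xb + CtoH yb * unit_j) =
  CtoH (xa^* * c * xb + ya * c^* * yb^*)
  + CtoH (xa^* * c * yb - ya * c^* * xb^*) * unit_j.
Proof.
rewrite !CtoH_joinE.
case: xa ya c xb yb => [x1 x2] [y1 y2] [c1 c2] [z1 z2] [w1 w2].
rewrite -[LHS]/(Defs.mulq (Defs.mulq (conjq (Quat x1 x2 y1 y2)) (Quat c1 c2 0 0))
  (Quat z1 z2 w1 w2)) /=.
by congr Quat; ring.
Qed.

(** The summation indices are swapped so that the (a, b) term involves [A a b], as in
    [joinH_form_entry]. *)
Lemma adj_formE (R : realType) (n : nat) (A : 'M[R[i]]_n) (x y : 'cV[R[i]]_n) :
  (x ^t* *m A ^t* *m y) 0 0 = \sum_a \sum_b y a 0 * (A a b)^* * (x b 0)^*.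
Proof.
rewrite mx_formE exchange_big; apply: eq_bigr => a _; apply: eq_bigr => b _.
by rewrite !mxE; ring.
Qed.

Lemma qformH_joinH (R : realType) (n : nat) (A : 'M[R[i]]_n)
    (x y : 'cV[R[i]]_n) :
  qformH (map_mx (@CtoH R) A) (joinH x y) =
  CtoH ((x ^t* *m A *m x + y ^t* *m A ^t* *m y) 0 0)
  + CtoH ((x ^t* *m (A - A ^t*) *m y) 0 0) * unit_j.
Proof.
rewrite mulmxBr mulmxBl [in RHS]mxE [X in _ + CtoH X * _]mxE.
rewrite [X in _ + CtoH (_ + X) * _]mxE !adj_formE /qformH !mx_formE.
(* All sums on the right merge into one double sum, to be compared term by term. *)
rewrite -sumrN -!big_split /= !rmorph_sum mulr_suml -big_split.
apply: eq_bigr => a _; rewrite -sumrN -!big_split /= !rmorph_sum mulr_suml.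
rewrite -big_split; apply: eq_bigr => b _.
by rewrite !mxE joinH_form_entry.
Qed.

(** [qformH_joinH] at the identity has no j part and leaves x^* x + y^* y, the squared norm of the
    stacked column. *)
Lemma sphereH_joinH (R : realType) (n : nat) (x y : 'cV[R[i]]_n) :
  sphereH (joinH x y) <-> sphereC2 (x, y).
Proof.
have mx1P (K : nzRingType) (M : 'M[K]_1) : M = 1%:M <-> M 0 0 = 1.
  split=> [->|M1]; first by rewrite mxE.
  by apply/matrixP => i j; rewrite !ord1 M1 mxE.
have := qformH_joinH R n 1%:M x y.
rewrite map_mx1 /qformH trmx1 map_mx1 subrr !mulmx1 mulmx0 mul0mx.
rewrite [X in CtoH X * _]mxE rmorph0 mul0r addr0 => qE.
rewrite /sphereH /sphereC2 /sphereC /= !mx1P qE.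
rewrite tr_col_mx map_row_mx mul_row_col.
by split=> [|->]; rewrite ?rmorph1 // -[1](rmorph1 (@CtoH R)) => /CtoH_inj.
Qed.

Lemma sub_adj_herm_diag (R : realType) (n : nat) (H : 'M[R[i]]_n) (S : 'M[R]_n)
    (A := H + 'i%C *: map_mx (real_complex R) S) :
  H \is hermsymmx -> is_diag_mx S ->
  A - A ^t* = (2 * 'i%C) *: map_mx (real_complex R) S.
Proof.
move=> /is_hermitianmxP; rewrite expr0 scale1r => hH /is_diag_mxP hS.
apply/matrixP => a b; rewrite {}/A.
have /matrixP/(_ a b) := hH; rewrite !mxE => ->.
(* A diagonal matrix is symmetric, and S is real, so i S is skew-Hermitian. *)
have -> : S b a = S a b.
  have [->//|ab] := eqVneq a b.
  by rewrite !hS // eq_sym.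
case: (H b a) => h1 h2; apply/eqP; rewrite eq_complex.
by apply/andP; split; apply/eqP => /=; ring.
Qed.

(** Once q lies on the sphere, its form value is in the numerical range, so membership in the bild
    only asks that the j part vanish. *)
Lemma D0E (R : realType) (n : nat) (A : 'M[R[i]]_n) (x y : 'cV[R[i]]_n) :
  D0 A (x, y) <-> sphereC2 (x, y) /\ x ^t* *m (A - A ^t*) *m y = 0.
Proof.
rewrite /D0 /bild /= qformH_joinH.
have e0 (M : 'M[R[i]]_1) : M 0 0 = 0 <-> M = 0.
  split=> [M0|->]; last by rewrite mxE.
  by apply/matrixP => i j; rewrite !ord1 M0 mxE.
split=> [[xyS [_ [_ /CtoH_join_range/e0]]] //|[xyS xy0]].
have qS : sphereH (joinH x y) by apply/sphereH_joinH.
split=> //; split=> //; split; last by apply/CtoH_join_range/e0.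
by exists (joinH x y); rewrite // qformH_joinH.
Qed.

Lemma bildE (R : realType) (n : nat) (A : 'M[R[i]]_n) :
  bild (map_mx (@CtoH R) A) =
    [set CtoH ((xy.1 ^t* *m A *m xy.1 + xy.2 ^t* *m A ^t* *m xy.2) 0 0)
       | xy in D0 A].
Proof.
apply/seteqP; split=> [_ [[q qS <-] qC]|_ [[x y] xyD <-]].
  have [[x y] /= [qE _]] := joinH_unique q; subst q.
  have xyD : D0 A (x, y).
    by split; [exact/sphereH_joinH|split=> //; split=> //; exists (joinH x y)].
  exists (x, y) => //=; move/D0E: xyD => [_ xy0].
  by rewrite qformH_joinH xy0 [X in _ + CtoH X * _]mxE rmorph0 mul0r addr0.
(* [D0] already contains membership in the bild; only the value needs rewriting. *)
have /D0E[_ xy0] := xyD; case: xyD => _ [_ /=].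
by rewrite qformH_joinH xy0 [X in _ + CtoH X * _]mxE rmorph0 mul0r addr0.
Qed.

Theorem proposition3p1 (R : realType) (n : nat)
    (A H : 'M[R[i]]_n) (S : 'M[R]_n)
    (hH : H \is hermsymmx) (hS : is_diag_mx S)
    (hA : A = H + 'i%C *: map_mx (real_complex R) S) :
  D0 A = [set xy | sphereC2 xy /\
           xy.1 ^t* *m map_mx (real_complex R) S *m xy.2 = 0]
  /\
  bild (map_mx (@CtoH R) A) =
    [set CtoH ((xy.1 ^t* *m A *m xy.1 + xy.2 ^t* *m A ^t* *m xy.2) 0 0)
       | xy in D0 A].
Proof.
split; last exact: bildE.
(* The factor 2 i of A - A^* = 2 i S has to be cancelled. *)
have i2_neq0 : 2 * 'i%C != 0 :> R[i].
  by rewrite mulf_neq0 ?pnatr_eq0 // eq_complex /= oner_eq0 andbF.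
apply/seteqP; split=> -[x y] /=; rewrite D0E hA sub_adj_herm_diag //;
  rewrite -scalemxAr -scalemxAl => -[xyS xy0]; split=> //.
  by apply/eqP; move/eqP: xy0; rewrite scaler_eq0 (negPf i2_neq0).
by rewrite xy0 scaler0.
Qed.
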